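(* Let $N,k$ be positive integers with $N\ge 2k+1$, let $G$ be a connected $r$-regular graph on $m$ vertices, and let $X=C_N^k\square G$. For two distinct vertices $x,y\in V(X)$, we have $$F_X(x\mid y)=\frac{\tau(X)}{Nm(2k+r)}\left\{h_X(x,y)+h_X(y,x)\right\}.$$
   Context: All graphs are finite, simple and undirected; $\mathbb Z_N=\mathbb Z/N\mathbb Z$. $C_N^k$ is the graph with vertex set $\mathbb Z_N$ in which $x,y$ are adjacent iff $x-y\equiv\pm s\pmod N$ for some $1\le s\le k$ (it is $2k$-regular since $N\ge 2k+1$). $X=C_N^k\square G$ is the Cartesian product: vertex set $\mathbb Z_N\times V(G)$, with $(x,a)$ and $(y,b)$ adjacent iff ($a=b$ and $x,y$ are adjacent in $C_N^k$) or ($x=y$ and $a,b$ are adjacent in $G$). $h_X(u,v)$ is the expected value of $T_v=\inf\{t\ge 0: Z_t=v\}$ for the simple random walk $(Z_t)$ on $X$ started at $u$ (each step moves to a uniformly random neighbour). $\tau(X)$ is the number of spanning trees of $X$. For distinct vertices $x,y$, $F_X(x\mid y)$ is the number of spanning forests of $X$ with exactly two connected components in which $x$ and $y$ belong to different components. *)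

(* Defs.v *)
From HB Require Import structures.
From mathcomp Require Import all_boot all_order all_algebra.
From mathcomp Require Import all_classical all_reals all_analysis.

Set Implicit Arguments.
Unset Strict Implicit.
Unset Printing Implicit Defensive.

Import Order.TTheory GRing.Theory Num.Theory.
Local Open Scope ring_scope.
Local Open Scope classical_set_scope.

(* A finite simple graph is a symmetric irreflexive relation on a finType. *)

Definition deg (V : finType) (e : rel V) (a : V) : nat := #|[pred b | e a b]|.

Definition regular (V : finType) (e : rel V) (r : nat) : Prop :=
  forall a : V, deg e a = r.

Definition connected_graph (V : finType) (e : rel V) : Prop :=
  forall a b : V, connect e a b.

Definition acyclic_graph (V : finType) (e : rel V) : Prop :=
  forall c : seq V, ucycle e c -> (size c <= 2)%N.

(* C_N^k; 'Z_N is Z/NZ only when N > 1. *)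
Definition cycle_power (N k : nat) : rel 'Z_N :=
  fun x y => [exists s : 'I_k.+1,
    (0 < s)%N && ((x - y == s%:R) || (x - y == - s%:R))].

Definition cartesian_product (V W : finType) (e : rel V) (f : rel W) :
    rel (V * W)%type :=
  fun p q => ((p.2 == q.2) && e p.1 q.1) || ((p.1 == q.1) && f p.2 q.2).

(* Spanning subgraphs are identified with their edge sets. *)

Definition edges (V : finType) (e : rel V) : {set {set V}} :=
  [set [set p.1; p.2]%SET | p in [pred p : V * V | e p.1 p.2]]%SET.

Definition subgraph (V : finType) (A : {set {set V}}) : rel V :=
  fun a b => (a != b) && ([set a; b]%SET \in A).

Definition spanning_trees (V : finType) (e : rel V) : {set {set {set V}}} :=
  [set A : {set {set V}} | (A \subset edges e) &&
    `[< connected_graph (subgraph A) /\ acyclic_graph (subgraph A) >]]%SET.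

Definition tau (V : finType) (e : rel V) : nat := #|spanning_trees e|.

Definition separating_2forests (V : finType) (e : rel V) (x y : V) :
    {set {set {set V}}} :=
  [set A : {set {set V}} | [&& A \subset edges e,
    `[< acyclic_graph (subgraph A) >],
    n_comp (subgraph A) predT == 2 & ~~ connect (subgraph A) x y]]%SET.

Definition F2 (V : finType) (e : rel V) (x y : V) : nat :=
  #|separating_2forests e x y|.

Definition step_prob (R : realType) (V : finType) (e : rel V) (a b : V) : R :=
  if e a b then (deg e a)%:R^-1 else 0.

(* Z_0 = u a.s., and given any history (Z_0, ..., Z_n) the next position is a
   uniform neighbour of Z_n. The conditional law is stated in product form, so
   that histories of probability zero need no separate treatment. *)
Definition simple_random_walk (R : realType) (d : measure_display)
    (Omega : measurableType d) (P : probability Omega R)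
    (V : finType) (e : rel V) (u : V) (Z : nat -> Omega -> V) : Prop :=
  [/\ forall t a, measurable [set w | Z t w = a],
      P [set w | Z 0%N w = u] = 1%E &
      forall (n : nat) (s : nat -> V),
        P [set w | forall i, (i <= n.+1)%N -> Z i w = s i] =
        (P [set w | forall i, (i <= n)%N -> Z i w = s i] *
         (step_prob R e (s n) (s n.+1))%:E)%E].

(* The infimum is +oo when v is never visited. *)
Definition hitting_time (R : realType) (Omega : Type) (V : finType)
    (Z : nat -> Omega -> V) (v : V) (w : Omega) : \bar R :=
  ereal_inf [set (t%:R)%:E | t in [set t : nat | Z t w = v]].

(* 'E_P[_] only takes real-valued random variables; this is the expectation of
   the extended-real-valued hitting time. *)
Definition expected_hitting_time (R : realType) (d : measure_display)
    (Omega : measurableType d) (P : probability Omega R) (V : finType)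
    (Z : nat -> Omega -> V) (v : V) : \bar R :=
  (\int[P]_w hitting_time R Z v w)%E.

(* Main.v *)
(* Let [H_y(u)] be the sum over the vertices [z], weighted by [deg z], of the number
   of two-component forests with [u] and [z] in one component and [y] in the other.
   Adding an edge [uw] to a forest that separates [u] from [w] gives a spanning tree,
   and counting the pairs (tree, edge of the tree at [u]) gives, for [u <> y],
   [deg u * H_y(u) = (sum of H_y(w) over the neighbours w of u) + tau * deg u].
   So [H_y / tau] solves the equations of the expected hitting time of [y], and it is
   the hitting time because [h(Z_t)] decreases on average by 1 per step before [y] is
   hit. Finally [H_y(x) + H_x(y) = F(x|y) * vol], since every vertex lies in exactly
   one component of a forest separating [x] from [y]. *)
Require Import Defs.
From mathcomp Require Import all_boot all_order all_algebra.
From mathcomp Require Import all_classical all_reals all_analysis.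
From mathcomp Require Import zify ring.

Set Implicit Arguments.
Unset Strict Implicit.
Unset Printing Implicit Defensive.

Import Order.TTheory GRing.Theory Num.Theory.
Local Open Scope ring_scope.

(** * Trees and forests as edge sets *)

Section EdgeSets.
Variable V : finType.
Implicit Types (A B T : {set {set V}}) (a b u v w z : V).

Local Notation conn A := (connect (subgraph A)).

Lemma set2_eqP a b u v :
  reflect (a = u /\ b = v \/ a = v /\ b = u) ([set a; b]%SET == [set u; v]%SET).
Proof.
apply: (iffP eqP) => [E | [[-> ->] //|[-> ->]]]; last by rewrite finset.setUC.
have: a \in [set u; v]%SET by rewrite -E set21.
have: b \in [set u; v]%SET by rewrite -E set22.
have: u \in [set a; b]%SET by rewrite E set21.
have: v \in [set a; b]%SET by rewrite E set22.
rewrite !inE => /orP[]/eqP-> /orP[]/eqP-> /orP[]/eqP + /orP[]/eqP +;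
  by intuition congruence.
Qed.

Lemma subgraph_sym A : symmetric (subgraph A).
Proof. by move=> a b; rewrite /subgraph eq_sym finset.setUC. Qed.

Lemma conn_sym A a b : conn A a b = conn A b a.
Proof. exact: (sym_connect_sym (@subgraph_sym A)). Qed.

Lemma conn_sub A B : A \subset B -> subrel (conn A) (conn B).
Proof.
move=> /fintype.subsetP AB; apply: connect_sub => a b /andP[ab abA].
by apply: connect1; rewrite /subgraph ab AB.
Qed.

Lemma conn_edge A u w : [set u; w]%SET \in A -> conn A u w.
Proof.
by have [->//|uw uwA] := eqVneq u w; apply: connect1; rewrite /subgraph uw.
Qed.

(** Induction along the path: when its first edge is the new one, it starts at [u] or [w], and each
    alternative for the rest reduces to one of these. *)
Lemma conn_setU1 A u w a b : conn ([set u; w]%SET |: A) a b ->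
  [|| conn A a b, conn A a u && conn A w b | conn A a w && conn A u b].
Proof.
case/connectP => p; elim: p a => [|c p IHp] a /=; first by move=> _ ->; rewrite connect0.
case/andP=> /andP[ac]; rewrite !inE => acUA cp bE.
have {cp bE} := IHp c cp bE; case/orP: acUA => [/set2_eqP[][-> ->]|acA].
- by case/or3P=> [->|/andP[_ ->]|/andP[_ ->]]; rewrite ?connect0 ?orbT.
- by case/or3P=> [->|/andP[_ ->]|/andP[_ ->]]; rewrite ?connect0 ?orbT.
have ac1 : conn A a c by apply: conn_edge.
have tr z : conn A c z -> conn A a z by apply: connect_trans.
by case/or3P=> [/tr->|/andP[/tr-> ->]|/andP[/tr-> ->]]; rewrite ?orbT.
Qed.

Lemma conn_setD1 A u w a b : conn A a b ->
  let C := A :\ [set u; w]%SET in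
  [|| conn C a b, conn C a u && conn C w b | conn C a w && conn C u b].
Proof.
move=> cab /=; apply: conn_setU1; apply: conn_sub cab.
by apply/fintype.subsetP => E EA; rewrite !inE EA andbT orbN.
Qed.

(** All edges of the path have both ends different from [u], so none of them is [uw]. *)
Lemma path_avoid A u w p : path (subgraph A) w p -> u \notin w :: p ->
  conn (A :\ [set u; w]%SET) w (last w p).
Proof.
move=> wp uwp; apply/connectP; exists p => //.
have : path (fun a b => subgraph A a b && (u \notin [:: a; b])) w p.
  elim: p w wp uwp => //= b p IHp a /andP[-> bp] uabp.
  rewrite IHp // ?andbT.
    by apply: contra uabp; rewrite !inE => /orP[]->; rewrite ?orbT.
  by apply: contra uabp => ubp; rewrite in_cons ubp orbT.
apply: sub_path => a b /andP[/andP[ab abA]]; rewrite !inE => /norP[ua ub].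
rewrite /subgraph ab !inE abA andbT /=; apply/set2_eqP.
by case=> -[Ea Eb]; [rewrite Ea eqxx in ua | rewrite Eb eqxx in ub].
Qed.

(** A cycle through [uw] is this edge closed up by a path that avoids it, so acyclicity means that
    every edge is a bridge; in this form it is easy to follow under insertion and deletion of
    edges. *)
Lemma acyclicP A : acyclic_graph (subgraph A) <->
  forall u w, u != w -> [set u; w]%SET \in A ->
    ~~ conn (A :\ [set u; w]%SET) u w.
Proof.
split=> [acA u w uw uwA | bridge c].
  apply/negP => /connectP[p0 up0]; case/shortenP: up0 => p up Up _ wE.
  have sub : subrel (subgraph (A :\ [set u; w]%SET)) (subgraph A).
    by move=> a b /andP[ab]; rewrite !inE => /andP[_ abA]; rewrite /subgraph ab.
  have := acA (u :: p).
  rewrite /ucycle /cycle rcons_path (sub_path sub up) Up -wE.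
  rewrite /subgraph eq_sym uw finset.setUC uwA => /(_ isT).
  (* Acyclicity leaves at most one vertex in [p]: none would give [u = w], and a single one would
     make the path the deleted edge itself. *)
  case: p up wE {Up} => [_ wE|b [|//]] /=; first by rewrite wE eqxx in uw.
  by move=> /[swap] <-; rewrite /subgraph !inE eqxx andbF.
case: c => [|a [|b [|d c]]] // /andP[]; rewrite /cycle /= => /andP[/andP[ab abA]].
case/andP=> bd; rewrite rcons_path => /andP[dc la] /andP[aN].
case/andP=> bN _.
have := bridge a b ab abA; rewrite conn_sym => /negP[].
have bc : path (subgraph A) b (d :: c) by rewrite /= bd.
(* From [b] on, the cycle returns to [a] without using [ab]: it meets [a] only in its closing edge,
   whose other end is not [b]. *)
apply: connect_trans (path_avoid bc aN) _ => /=.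
apply: connect1; move: la => /andP[laa laA]; rewrite /subgraph laa !inE laA andbT /=.
apply/set2_eqP => -[[_ E]|[E _]]; first by rewrite E eqxx in ab.
by move: bN; rewrite -E mem_last.
Qed.

Lemma acyclic_sub A B : A \subset B ->
  acyclic_graph (subgraph B) -> acyclic_graph (subgraph A).
Proof.
move=> AB /acyclicP acB; apply/acyclicP => u w uw uwA.
have := acB u w uw (fintype.subsetP AB _ uwA); apply: contra.
by apply: conn_sub; rewrite finset.setSD.
Qed.

(** If another edge [ab] stopped being a bridge, the detour around it would pass through [uw]; its
    remaining pieces and [ab] would then join [u] to [w] inside [A]. *)
Lemma acyclic_setU1 A u w : ~~ conn A u w ->
  acyclic_graph (subgraph A) -> acyclic_graph (subgraph ([set u; w]%SET |: A)).
Proof.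
move=> Nuw /acyclicP acA; apply/acyclicP => a b ab.
have NuwA : [set u; w]%SET \notin A by apply: contra Nuw => /conn_edge.
have [/set2_eqP E _|Nab] := boolP ([set a; b]%SET == [set u; w]%SET).
  by case: E => -[-> ->]; [|rewrite (finset.setUC [set w]%SET) conn_sym]; rewrite setU1K.
rewrite !inE (negPf Nab) /= => abA; apply/negP => cab.
have Cab := acA a b ab abA; set C := A :\ _ in Cab.
have CA : subrel (conn C) (conn A) by apply: conn_sub; rewrite subD1set.
have {cab} : conn ([set u; w]%SET |: C) a b.
  apply: conn_sub cab; apply/fintype.subsetP => E; rewrite !inE.
  by case/andP=> -> /orP[->|->]; rewrite ?orbT.
have cAab := conn_edge abA.
case/conn_setU1/or3P => [|/andP[au wb]|/andP[aw ub]]; first exact/negP.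
- case/negP: Nuw; apply: connect_trans (connect_trans _ cAab) _.
    by rewrite conn_sym; apply: CA.
  by rewrite conn_sym; apply: CA.
- case/negP: Nuw; apply: connect_trans (CA _ _ ub) _.
  by rewrite conn_sym in cAab; apply: connect_trans cAab (CA _ _ aw).
Qed.

Lemma connected_setD1 T u w : connected_graph (subgraph T) ->
  forall z, conn (T :\ [set u; w]%SET) u z || conn (T :\ [set u; w]%SET) w z.
Proof.
by move=> cT z; case/or3P: (conn_setD1 u w (cT u z)) => [->|/andP[_ ->]|/andP[_ ->]];
  rewrite ?orbT.
Qed.

(* In a spanning tree, the first vertex after [u] on the path from [u] to [z]. *)
Definition exits T u z : {set V} :=
  [set w | [&& u != w, [set u; w]%SET \in T & ~~ conn (T :\ [set u; w]%SET) u z]]%SET.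

Lemma in_exits T u z w : (w \in exits T u z) =
  [&& u != w, [set u; w]%SET \in T & ~~ conn (T :\ [set u; w]%SET) u z].
Proof. exact: finset.in_set. Qed.

(** The simple path from [u] to [z] in a tree is unique and leaves [u] by a single edge, unless
    [u = z]. *)
Lemma card_exits T u z : connected_graph (subgraph T) ->
  acyclic_graph (subgraph T) -> #|exits T u z| = (u != z).
Proof.
move=> cT /acyclicP acT; have [<-|uz] := eqVneq u z.
  by apply/eqP; rewrite cards_eq0; apply/eqP/setP => w; rewrite !inE connect0 !andbF.
have [w wE] : exists w, w \in exits T u z.
  case/connectP: (cT u z) => p0 up0 zE; move: zE uz; case/shortenP: up0 => p up Up _ -> uz.
  case: p up Up uz => [|w p]; first by rewrite eqxx.
  rewrite /= => /andP[/andP[uw uwT] wp] /andP[uwp _] _.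
  exists w; rewrite inE uw uwT /=; apply: contra (acT u w uw uwT) => cuz.
  by apply: connect_trans cuz _; rewrite conn_sym; apply: path_avoid.
suff -> : exits T u z = [set w]%SET by rewrite cards1.
apply/setP => w'; rewrite finset.in_set1; apply/idP/eqP => [w'E|->//].
apply/eqP/negP => /negP ww'.
(* With both edges removed each exit still reaches [z]: otherwise [u] would be joined to [a], or to
   [z], without the edge [ua]. *)
have key a b : a \in exits T u z -> b \in exits T u z ->
    conn (T :\ [set u; a]%SET :\ [set u; b]%SET) a z.
  rewrite !inE => /and3P[ua uaT auz] /and3P[ub ubT buz].
  have caz : conn (T :\ [set u; a]%SET) a z.
    by have := connected_setD1 u a cT z; rewrite (negPf auz).
  case/or3P: (conn_setD1 u b caz) => // /andP[c1 c2].
    case/negP: (acT u a ua uaT); rewrite conn_sym.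
    by apply: conn_sub c1; rewrite subD1set.
  by case/negP: auz; apply: conn_sub c2; rewrite subD1set.
have k1 := key _ _ wE w'E; have k2 := key _ _ w'E wE.
move: wE w'E; rewrite !inE => /and3P[uw uwT wuz] /and3P[uw' uw'T _].
(* The route from [u] through [w'] to [z] avoids [uw], so [w] cannot be an exit. *)
case/negP: wuz.
have cuw' : conn (T :\ [set u; w]%SET) u w'.
  apply: conn_edge; rewrite !inE uw'T andbT; apply/set2_eqP.
  case=> -[E1 E2]; first by rewrite E2 eqxx in ww'.
  by rewrite E2 eqxx in uw'.
apply: connect_trans cuw' _; apply: conn_sub k2.
by apply/fintype.subsetP => E; rewrite !inE => /and3P[-> _ ->].
Qed.

End EdgeSets.

(** * Counting forests *)

Section Counting.
Variables (V : finType) (e : rel V).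
Hypotheses (e_sym : symmetric e) (e_irr : irreflexive e).
Hypothesis e_conn : connected_graph e.
Implicit Types (A B T : {set {set V}}) (a b u v w x y z : V).

Local Notation conn A := (connect (subgraph A)).

Lemma mem_edges u w : ([set u; w]%SET \in edges e) = e u w.
Proof.
apply/imsetP/idP => [[[a b]] /= + /eqP /set2_eqP E|uw]; last by exists (u, w).
by rewrite inE /=; case: E => -[-> ->] //; rewrite e_sym.
Qed.

Lemma spanning_treeP T :
  reflect [/\ T \subset edges e, connected_graph (subgraph T)
            & acyclic_graph (subgraph T)]
          (T \in spanning_trees e).
Proof.
rewrite inE; apply: (iffP andP) => [[Te /asboolP[]] //|[Te cT aT]].
by split=> //; apply/asboolP.
Qed.

(** An inclusion-minimal connected set of edges is a tree, since an edge that is not a bridge could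
    be removed. *)
Lemma tau_gt0 : (0 < tau e)%N.
Proof.
pose P A := (A \subset edges e) && [forall a, forall b, conn A a b].
have [|T /minsetP[/andP[Te /forallP cT] minT]] := @ex_minset _ P.
  exists (edges e); rewrite /P subxx; apply/forallP => a; apply/forallP => b.
  apply: connect_sub (e_conn a b) => {}a {}b ab; apply: connect1.
  rewrite /subgraph mem_edges ab andbT.
  by apply: contraTneq ab => ->; rewrite e_irr.
have {}cT : connected_graph (subgraph T) by move=> a b; apply/forallP: b.
apply/card_gt0P; exists T; apply/spanning_treeP; split=> //.
apply/acyclicP => u w uw uwT; apply/negP => cuw.
have /setP/(_ [set u; w]%SET) : T :\ [set u; w]%SET = T.
  apply: minT; last exact: subD1set.
  rewrite /P (fintype.subset_trans (subD1set _ _) Te).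
  apply/forallP => a; apply/forallP => b.
  have cwu : conn (T :\ [set u; w]%SET) w u by rewrite conn_sym.
  case/or3P: (conn_setD1 u w (cT a b)) => // /andP[c1 c2].
    exact: connect_trans c1 (connect_trans cuw c2).
  exact: connect_trans c1 (connect_trans cwu c2).
by rewrite !inE eqxx uwT.
Qed.

(** The components of [x] and [y] already account for the total of two, so no component root lies
    outside their union, which is therefore everything. *)
Lemma separating_2forestP A x y :
  reflect [/\ A \subset edges e, acyclic_graph (subgraph A), ~~ conn A x y
            & forall z, conn A x z || conn A y z]
          (A \in separating_2forests e x y).
Proof.
have Asym := sym_connect_sym (@subgraph_sym _ A).
have Acl := closure_closed Asym (pred2 x y).
have E := n_compC (fingraph.closure (subgraph A) (pred2 x y)) (subgraph A).
rewrite (n_comp_closure2 Asym) in E.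
have clE z : (z \in fingraph.closure (subgraph A) (pred2 x y)) = conn A x z || conn A y z.
  rewrite -topredE /= /closure_mem /disjoint; apply/pred0Pn/orP => [[v /andP[/= zv]]|[] xz].
  - by move/pred2P => -[] vE; [left|right]; rewrite conn_sym -vE.
  - by rewrite conn_sym in xz; exists x; apply/andP; split; rewrite ?inE ?eqxx.
  - by rewrite conn_sym in xz; exists y; apply/andP; split; rewrite ?inE ?eqxx ?orbT.
rewrite inE; apply: (iffP and4P) => [[Ae /asboolP aA /eqP n2 Nxy]|[Ae aA Nxy cA]].
  split=> // z; rewrite -clE; apply: contraT => Nz.
  move: E; rewrite n2 Nxy => /eqP; rewrite eq_sym -[X in _ == X]addn0 eqn_add2l.
  move=> /eqP/card0_eq/(_ (fingraph.root (subgraph A) z)).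
  by rewrite !inE roots_root //= -(closed_connect Acl (connect_root _ z)) Nz.
split=> //; first by apply/asboolP.
rewrite E Nxy (@eq_n_comp_r _ _ _ pred0) => [|z].
  by rewrite /n_comp_mem eq_card0 // => z; rewrite !inE andbF.
by rewrite !inE clE cA.
Qed.

Lemma in_setId (T : finType) (A : {set T}) (P : pred T) (c : T) :
  (c \in [set b in A | P b]%SET) = (c \in A) && P c.
Proof. exact: finset.in_set. Qed.

Lemma separating_2forestsC x y :
  separating_2forests e x y = separating_2forests e y x.
Proof.
apply/setP => A; apply/separating_2forestP/separating_2forestP => -[Ae aA Nxy cA];
  by split=> // [|z]; [rewrite conn_sym | rewrite orbC].
Qed.

Definition rooted_forests u z y : {set {set {set V}}} :=
  [set A in separating_2forests e u y | conn A u z]%SET.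

(** Inserting and deleting [uw] are inverse bijections between these forests and the trees through
    [uw]; [P] always tests the forest, which is [T] without [uw]. *)
Lemma card_tree_edge (P : pred {set {set V}}) u w : e u w ->
  #|[set A in separating_2forests e u w | P A]%SET| =
  #|[set T in spanning_trees e |
      ([set u; w]%SET \in T) && P (T :\ [set u; w]%SET)]%SET|.
Proof.
move=> uw; have uNw : u != w by apply: contraTneq uw => ->; rewrite e_irr.
set E := [set u; w]%SET.
have NEA A : A \in separating_2forests e u w -> E \notin A.
  by case/separating_2forestP=> _ _ Nuw _; apply: contra Nuw => /conn_edge.
rewrite -(@card_in_imset _ _ (fun A => E |: A)); last first.
  move=> A B; rewrite !in_setId => /andP[SA _] /andP[SB _] EAB.
  by rewrite -(setU1K (NEA _ SA)) EAB setU1K ?NEA.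
apply: eq_card => T; apply/imsetP/idP => [[A]|].
  rewrite in_setId => /andP[SA PA] ->{T}; have NA := NEA _ SA.
  rewrite in_setId setU11 setU1K // PA !andbT.
  case/separating_2forestP: SA => Ae aA Nuw cA; apply/spanning_treeP.
  have cu a : conn (E |: A) u a.
    have sub : subrel (conn A) (conn (E |: A)) by apply: conn_sub; apply: finset.subsetUr.
    case/orP: (cA a) => [/sub//|/sub]; apply: connect_trans.
    by apply: conn_edge; rewrite setU11.
  split; last exact: acyclic_setU1.
    by rewrite finset.subUset Ae andbT finset.sub1set mem_edges.
  by move=> a b; apply: connect_trans (cu b); rewrite conn_sym.
rewrite in_setId => /and3P[/spanning_treeP[Te cT aT] ET PT].
exists (T :\ E); last by rewrite finset.setD1K.
rewrite in_setId PT andbT; apply/separating_2forestP; split.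
- exact: fintype.subset_trans (subD1set _ _) Te.
- exact: acyclic_sub (subD1set _ _) aT.
- by move/acyclicP: aT; apply.
- exact: connected_setD1.
Qed.

(** In the tree obtained by adding [uw], the conditions on [A] say that deleting [uw] cuts [u] off
    from [y] but not from [z], so [w] is an exit towards [y] and not towards [z]. Exchanging the
    sums counts such exits tree by tree. *)
Lemma sum_tree_exits u y z :
  (\sum_(w | e u w)
     #|[set A in separating_2forests e u w | conn A u z && ~~ conn A u y]%SET| =
   \sum_(T in spanning_trees e) #|exits T u y :\: exits T u z|)%N.
Proof.
under eq_bigr => w uw do rewrite card_tree_edge // -sum1_card big_mkcond /=.
rewrite exchange_big /= [RHS]big_mkcond; apply: eq_bigr => T _.
case: ifP => [|NT]; last by rewrite big1 // => w _; rewrite in_setId NT.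
move=> ST; case/spanning_treeP: (ST) => Te _ _.
rewrite -sum1_card [RHS]big_mkcond [LHS]big_mkcond /=; apply: eq_bigr => w _.
rewrite finset.in_setD !in_exits !in_setId ST /=; have [uw|Nuw] := boolP (e u w).
  have -> : u != w by apply: contraTneq uw => ->; rewrite e_irr.
  by case: (_ \in T) => //=; rewrite negbK.
case: ifP => // /andP[_ /and3P[_ /(fintype.subsetP Te)]].
by rewrite mem_edges (negPf Nuw).
Qed.

(* The forests connecting [u] and [w] cancel. Each of the others becomes a tree when
   the edge [uw] is added, and in that tree [u] has exactly one exit towards [y], and
   exactly one towards [z] unless [u = z]. *)
Lemma sum_rooted_forests u y z : u != y ->
  (\sum_(w | e u w) #|rooted_forests u z y| =
   \sum_(w | e u w) #|rooted_forests w z y| + (u == z) * tau e)%N.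
Proof.
move=> uy.
(* Membership depends only on the two components, so [a] and [b] may be replaced by other vertices
   of theirs. *)
have sepC A a b c d : A \in separating_2forests e a b ->
    conn A a c -> conn A b d -> A \in separating_2forests e c d.
  case/separating_2forestP=> Ae aA Nab cA ac bd; apply/separating_2forestP.
  split=> // [|v].
    apply: contra Nab => cd; apply: connect_trans ac (connect_trans cd _).
    by rewrite conn_sym.
  by case/orP: (cA v) => [av|bv]; apply/orP; [left|right];
    rewrite conn_sym; [apply: connect_trans ac|apply: connect_trans bd];
    rewrite conn_sym.
pose D w := [set A in separating_2forests e u w | conn A u z && ~~ conn A u y]%SET.
pose D' w := [set A in separating_2forests e u w | conn A u y && ~~ conn A u z]%SET.
have sumD : (\sum_(w | e u w) #|D w| = \sum_(w | e u w) #|D' w| + (u == z) * tau e)%N.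
  (* For the exit sets [Y] and [Z] towards [y] and [z], [|Y - Z| - |Z - Y| = |Y| - |Z|], which is 1
     if [u = z] and 0 otherwise. *)
  rewrite !sum_tree_exits /tau -sum1_card big_distrr -big_split /=.
  apply: eq_bigr => T /spanning_treeP[_ cT aT]; rewrite muln1.
  have := cardsID (exits T u z) (exits T u y).
  have := cardsID (exits T u y) (exits T u z).
  rewrite finset.setIC !card_exits // uy; case: eqP => _ /=; lia.
pose B w := [set A : {set {set V}} | conn A u w]%SET.
have inB A w : (A \in B w) = conn A u w by apply: finset.in_set.
(* A forest counted on the left that separates [u] from [w] has [w] on the side of [y]. *)
have splitD w : e u w ->
    #|rooted_forests u z y| = (#|rooted_forests u z y :&: B w| + #|D w|)%N.
  move=> uw; rewrite -(cardsID (B w)); congr (_ + _)%N.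
  apply: eq_card => A; rewrite finset.in_setD !in_setId !inB; apply/idP/idP.
    case/and3P=> Nuw SA uz; rewrite uz; case/separating_2forestP: (SA) => _ _ -> cA.
    rewrite !andbT; apply: (sepC _ _ _ _ _ SA) => //.
    by move: (cA w); rewrite (negPf Nuw).
  case/and3P=> SA -> Nuy; case/separating_2forestP: (SA) => _ _ -> cA.
  rewrite !andbT; apply: (sepC _ _ _ _ _ SA) => //.
  by move: (cA y); rewrite (negPf Nuy).
(* Here [u] is on the side of [y] when separated from [w]; the forests joining [u] and [w] are those
   of [splitD]. *)
have splitD' w : e u w ->
    #|rooted_forests w z y| = (#|rooted_forests u z y :&: B w| + #|D' w|)%N.
  move=> uw; rewrite -(cardsID (B w)); congr (_ + _)%N; apply: eq_card => A.
    rewrite !finset.in_setI !in_setId !inB.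
    have [uwA|] := boolP (conn A u w); last by rewrite !andbF.
    have wuA : conn A w u by rewrite conn_sym.
    rewrite !andbT; congr (_ && _).
      by apply/idP/idP => /sepC; apply.
    by apply/idP/idP; apply: connect_trans.
  rewrite finset.in_setD !in_setId !inB; apply/idP/idP.
    case/and3P=> Nuw SA wz; case/separating_2forestP: (SA) => _ _ Nwy cA.
    have yu : conn A y u by move: (cA u); rewrite conn_sym (negPf Nuw).
    rewrite [conn A u y]conn_sym yu /= separating_2forestsC (sepC _ _ _ _ _ SA) //=.
    by apply: contra Nuw => uz; apply: connect_trans uz _; rewrite conn_sym.
  case/and3P=> SA cuy Nuz; case/separating_2forestP: (SA) => _ _ -> cA.
  rewrite separating_2forestsC in SA; rewrite (sepC _ _ _ _ _ SA) //=.
  by move: (cA z); rewrite (negPf Nuz).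
by rewrite (eq_bigr _ splitD) (eq_bigr _ splitD') !big_split /= sumD addnA.
Qed.

Definition forest_weight u y : nat :=
  (\sum_z deg e z * #|rooted_forests u z y|)%N.

Lemma forest_weight_id y : forest_weight y y = 0%N.
Proof.
rewrite /forest_weight big1 // => z _; apply/eqP; rewrite muln_eq0; apply/orP; right.
rewrite cards_eq0; apply/eqP/setP => A; rewrite in_setId finset.in_set0.
by apply/negP => /andP[/separating_2forestP[_ _ /negP[]]].
Qed.

(** This is [sum_rooted_forests] summed over [z] with weights [deg e z]; only [z = u] brings the
    extra [tau e], with weight [deg e u]. *)
Lemma forest_weight_harmonic u y : u != y ->
  (deg e u * forest_weight u y =
   \sum_(w | e u w) forest_weight w y + deg e u * tau e)%N.
Proof.
move=> uy; rewrite /forest_weight [in RHS]exchange_big /= big_distrr /=.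
rewrite (bigD1 u) //= [in RHS](bigD1 u) //=.
have E z : (deg e u * #|rooted_forests u z y| =
    \sum_(w | e u w) #|rooted_forests w z y| + (u == z) * tau e)%N.
  by rewrite -sum_rooted_forests // sum_nat_const.
rewrite E eqxx mul1n mulnDr [in LHS]big_distrr /=.
rewrite -!addnA; congr (_ + _)%N; rewrite addnC; congr (_ + _)%N.
apply: eq_bigr => z zu; rewrite mulnCA E eq_sym (negPf zu) addn0.
by rewrite big_distrr.
Qed.

Lemma forest_weightD x y :
  (forest_weight x y + forest_weight y x = F2 e x y * \sum_z deg e z)%N.
Proof.
rewrite /forest_weight -big_split big_distrr /=; apply: eq_bigr => z _.
rewrite -mulnDr mulnC; congr (_ * _)%N.
pose B := [set A : {set {set V}} | conn A x z]%SET.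
have inB A : (A \in B) = conn A x z by apply: finset.in_set.
rewrite /F2 -[RHS](cardsID B); congr (_ + _)%N; apply: eq_card => A.
  by rewrite in_setId finset.in_setI inB.
rewrite in_setId finset.in_setD inB separating_2forestsC.
apply/andP/andP => -[H1 H2].
  case/separating_2forestP: (H1) => _ _ Nxy _; split=> //.
  by apply: contra Nxy => xz; apply: connect_trans xz _; rewrite conn_sym.
case/separating_2forestP: (H2) => _ _ _ cA; split=> //.
by move: (cA z); rewrite (negPf H1).
Qed.

End Counting.

(** * Hitting times *)

Section HittingTime.
Import numFieldNormedType.Exports.
Local Open Scope classical_set_scope.
Variables (R : realType) (d : measure_display) (Omega : measurableType d).
Variables (P : probability Omega R) (V : finType) (e : rel V) (x y : V).
Variable Z : nat -> Omega -> V.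
Hypothesis HZ : simple_random_walk P e x Z.
Implicit Types (a b : V) (n i j : nat) (E : set Omega).

Local Notation at_ n a := [set w | Z n w = a].
Local Notation pr E := (fine (P E)).

Definition survives n : set Omega := [set w | forall i, (i <= n)%N -> Z i w <> y].

Lemma measurable_at n a : measurable (at_ n a).
Proof. by case: HZ. Qed.

Lemma measurable_history n (Q : nat -> V -> Prop) :
  measurable [set w | forall i, (i <= n)%N -> Q i (Z i w)].
Proof.
have -> : [set w | forall i, (i <= n)%N -> Q i (Z i w)] =
    \bigcap_(i in [set i | (i <= n)%N]) \bigcup_(a in Q i) at_ i a.
  apply/seteqP; split=> w /= Hw i Hi; first by exists (Z i w) => //; exact: Hw.
  by have [a Qa ->] := Hw i Hi.
apply: bigcap_measurableType => i _; apply: fin_bigcup_measurable.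
  exact: (@finite_finset V).
by move=> a _; exact: measurable_at.
Qed.

Lemma measurable_survives n : measurable (survives n).
Proof. exact: (measurable_history n (fun _ a => a <> y)). Qed.

Lemma prE E : measurable E -> P E = (pr E)%:E.
Proof. by move=> mE; rewrite fineK // fin_num_measure. Qed.

Lemma pr_ge0 E : 0 <= pr E.
Proof. exact: fine_ge0. Qed.

Lemma pr_partition E n : measurable E -> pr E = \sum_a pr (E `&` at_ n a).
Proof.
move=> mE; apply: EFin_inj; rewrite -prE // -sumEFin.
have mEa a : measurable (E `&` at_ n a).
  by apply: measurableI => //; exact: measurable_at.
under eq_bigr => a _ do rewrite -prE //.
have -> : P E = P (\bigcup_(a in [set: V]) (E `&` at_ n a)).
  congr (P _); apply/seteqP; split=> w; first by move=> Ew; exists (Z n w).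
  by case=> a _ [].
rewrite (measure_fin_bigcup _ (@finite_finset V _)) //.
  rewrite [RHS]fsbig_seq ?index_enum_uniq // (_ : [set` index_enum V] = setT) //.
  by apply/seteqP; split=> a //= _; rewrite mem_index_enum.
by move=> a b _ _ [w [[_ <-] [_ <-]]].
Qed.

(** [j] counts the initial times at which the prescribed value is relaxed to avoiding [y]. For
    [j = 0] this is the law of the walk, and [j] grows by summing over the position at time [j]. The
    bound [j <= n] keeps [Z n] prescribed, which fixes the last factor. *)
Lemma markov_history n j (s : nat -> V) : (j <= n)%N ->
  pr [set w | forall i, (i <= n.+1)%N -> if (i < j)%N then Z i w <> y else Z i w = s i] =
  pr [set w | forall i, (i <= n)%N -> if (i < j)%N then Z i w <> y else Z i w = s i] *
  step_prob R e (s n) (s n.+1).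
Proof.
elim: j s => [|j IHj] s jn.
  by case: HZ => _ _ /(_ n s) ->; rewrite fineM // fin_num_measure //;
     exact: (measurable_history n (fun i a => a = s i)).
pose Q (s : nat -> V) k i a := if (i < k)%N then a <> y else a = s i.
rewrite (@pr_partition _ j); last exact: (measurable_history n.+1 (Q s j.+1)).
rewrite (@pr_partition [set w | forall i, (i <= n)%N -> _] j); last first.
  exact: (measurable_history n (Q s j.+1)).
rewrite big_distrl /=; apply: eq_bigr => a _.
(* The value [a = y] contributes 0 to both sides; any other [a] is recorded in the history [s']. *)
have [->|ay] := eqVneq a y.
  have N0 m : (j <= m)%N ->
      [set w | forall i, (i <= m)%N -> if (i < j.+1)%N then Z i w <> y else Z i w = s i]
        `&` at_ j y = set0.
    by move=> jm; apply/seteqP; split=> w //= -[/(_ j jm)]; rewrite ltnSn.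
  by rewrite !N0 ?measure0 ?mul0r //; lia.
pose s' i := if i == j then a else s i.
have split_a m : (j <= m)%N ->
    [set w | forall i, (i <= m)%N -> if (i < j.+1)%N then Z i w <> y else Z i w = s i]
      `&` at_ j a =
    [set w | forall i, (i <= m)%N -> if (i < j)%N then Z i w <> y else Z i w = s' i].
  move=> jm; apply/seteqP; split=> w /=.
    move=> [H Za] i im; rewrite /s'; have := H i im; rewrite ltnS [(i <= j)%N]leq_eqVlt.
    by case: eqP => [-> _|_ //]; rewrite ltnn.
  move=> H; have Za : Z j w = a by have := H j jm; rewrite ltnn /s' eqxx.
  split=> // i im; have := H i im; rewrite /s' ltnS [(i <= j)%N]leq_eqVlt.
  by case: eqP => [-> _ /=|//]; rewrite Za; apply/eqP.
rewrite !split_a; [|lia|lia].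
rewrite IHj; last lia.
rewrite /s' !ifN //; lia.
Qed.

Lemma markov_survives n a b :
  pr (survives n `&` at_ n a `&` at_ n.+1 b) =
  pr (survives n `&` at_ n a) * step_prob R e a b.
Proof.
have [->|ay] := eqVneq a y.
  by rewrite (_ : survives n `&` at_ n y = set0) ?set0I ?measure0 ?mul0r //;
    apply/seteqP; split=> w //= -[/(_ n (leqnn n))].
(* With [j = n] in [markov_history], only the values of [s] at [n] and [n.+1] matter. *)
pose s i := if i == n then a else b.
have := @markov_history n n s (leqnn n).
rewrite /s eqxx ifN; last lia.
suff [-> ->] : survives n `&` at_ n a = [set w | forall i, (i <= n)%N ->
      if (i < n)%N then Z i w <> y else Z i w = s i] /\
    survives n `&` at_ n a `&` at_ n.+1 b = [set w | forall i, (i <= n.+1)%N ->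
      if (i < n)%N then Z i w <> y else Z i w = s i] by [].
have sn : s n = a by rewrite /s eqxx.
have sn1 : s n.+1 = b by rewrite /s ifN //; lia.
split; apply/seteqP; split=> w /=.
- move=> [H Za] i; rewrite leq_eqVlt => /orP[/eqP->|lt_in].
    by rewrite ltnn sn.
  by rewrite lt_in; apply: H; lia.
- move=> H; have Za : Z n w = a by have := H n (leqnn n); rewrite ltnn sn.
  split=> // i; rewrite leq_eqVlt => /orP[/eqP->|lt_in].
    by rewrite Za; apply/eqP.
  by have := H i (ltnW lt_in); rewrite lt_in.
- move=> [[H Za] Zb] i; rewrite leq_eqVlt => /orP[/eqP->|].
    by rewrite ifN ?sn1 //; lia.
  rewrite ltnS leq_eqVlt => /orP[/eqP->|lt_in]; first by rewrite ltnn sn.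
  by rewrite lt_in; apply: H; lia.
- move=> H; have Za : Z n w = a by have := H n (leqnSn n); rewrite ltnn sn.
  split; last by have := H n.+1 (leqnn _); rewrite ifN ?sn1 //; lia.
  split=> // i; rewrite leq_eqVlt => /orP[/eqP->|lt_in].
    by rewrite Za; apply/eqP.
  by have := H i; rewrite lt_in; apply; lia.
Qed.

(** The tail formula for [T], pointwise: the terms are 1 before the first visit and 0 from then on;
    without a visit all are 1 and both sides are [+oo]. *)
Lemma hitting_time_series w :
  hitting_time R Z y w = (\sum_(0 <= n <oo) (\1_(survives n) w)%:E)%E.
Proof.
have [[t Zt]|Nt] := pselect (exists t, Z t w == y).
  have [n /eqP Zn nmin] := ex_minnP (ex_intro (fun t => Z t w == y) t Zt).
  have -> : hitting_time R Z y w = n%:R%:E.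
    apply/eqP; rewrite eq_le; apply/andP; split.
      by apply: ereal_inf_lbound; exists n.
    apply/ereal_infP => _ [m /= /eqP Zm <-].
    by rewrite lee_fin ler_nat nmin.
  rewrite (@nneseries_split _ _ 0 n) ?add0n; last by move=> k _; rewrite lee_fin.
  rewrite [X in (_ + X)%E]eseries0 ?adde0; last first.
    move=> k nk _; rewrite indicE memNset //= => /(_ n nk); apply.
    exact: Zn.
  rewrite sumEFin; congr EFin.
  rewrite -[LHS](_ : \sum_(0 <= k < n) 1 = _); last by rewrite sumr_const_nat subn0.
  apply: eq_big_nat => k /andP[_ kn]; rewrite indicE mem_set //= => i ik Zi.
  by have := nmin i; rewrite Zi eqxx => /(_ isT); lia.
have -> : hitting_time R Z y w = +oo%E.
  rewrite /hitting_time (_ : [set _ | _ in _] = set0) ?ereal_inf0 //.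
  by apply/seteqP; split=> // _ [m /= Zm _]; case: Nt; exists m; apply/eqP.
apply/esym/eqyP => A A0.
have [k Ak] : exists k : nat, A <= k%:R.
  by exists (Num.truncn A).+1; apply/ltW/truncnS_gt.
apply: le_trans (@nneseries_lim_ge _ _ xpredT 0 k _); last by move=> n _ _; rewrite lee_fin.
rewrite sumEFin lee_fin (le_trans Ak) //.
rewrite -[leLHS](_ : \sum_(0 <= i < k) 1 = _); last by rewrite sumr_const_nat subn0.
apply: ler_sum => i _; rewrite indicE mem_set //= => j _ Zj.
by apply: Nt; exists j; apply/eqP.
Qed.

(** Exchanging integral and nonnegative series gives [E[T]] as the sum of [P(T > n)], in the
    extended reals, so without presupposing finiteness. *)
Lemma expected_hitting_time_series :
  expected_hitting_time P Z y = (\sum_(0 <= n <oo) (pr (survives n))%:E)%E.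
Proof.
rewrite /expected_hitting_time.
under eq_integral => w _ do rewrite hitting_time_series.
rewrite integral_nneseries //.
- apply: eq_eseriesr => n _; rewrite (integral_indic _ measurableT (measurable_survives n)).
  by rewrite setIT -prE //; exact: measurable_survives.
- move=> n; apply/measurable_realfun.measurable_EFinP.
  by apply: measurable_realfun.measurable_indic; exact: measurable_survives.
Qed.

(* [M n = E[h(Z_n); T > n]] drops by [P(T > n)] at each step, so the sum of
   these probabilities telescopes. *)
Lemma expected_hitting_timeE (h : V -> R) : (forall a, 0 <= h a) -> h y = 0 ->
  (forall a, a != y -> h a = 1 + \sum_b step_prob R e a b * h b) ->
  x != y -> expected_hitting_time P Z y = (h x)%:E.
Proof.
move=> h_ge0 hy hE xy; rewrite expected_hitting_time_series.
pose M n := \sum_a pr (survives n `&` at_ n a) * h a.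
have mSa n a : measurable (survives n `&` at_ n a).
  by apply: measurableI; [exact: measurable_survives|exact: measurable_at].
have sy n : survives n `&` at_ n y = set0.
  by apply/seteqP; split=> w //= -[/(_ n (leqnn n))].
have P0C : P (~` at_ 0%N x) = 0%E.
  rewrite probability_setC; last exact: measurable_at.
  by case: HZ => _ -> _; rewrite subee.
have M0 : M 0%N = h x.
  rewrite /M (bigD1 x) //= big1 ?addr0 => [|a ax].
    rewrite (_ : survives 0 `&` at_ 0%N x = at_ 0%N x).
      by case: HZ => _ -> _; rewrite mul1r.
    apply/seteqP; split=> w /=; first by case.
    by move=> Zx; split=> // i; rewrite leqn0 => /eqP->; rewrite Zx; apply/eqP.
  suff -> : P (survives 0 `&` at_ 0%N a) = 0%E by rewrite mul0r.
  apply: (@subset_measure0 _ _ _ P _ (~` at_ 0%N x)) => //.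
  - by apply: measurableC; exact: measurable_at.
  - by move=> w /= -[_ ->] ax'; rewrite ax' eqxx in ax.
have MS n : M n.+1 = M n - pr (survives n).
  (* As [h y = 0], requiring survival up to [n] or up to [n.+1] gives the same sum. *)
  transitivity (\sum_b pr (survives n `&` at_ n.+1 b) * h b).
    apply: eq_bigr => b _; have [->|/eqP b_y] := eqVneq b y; first by rewrite hy !mulr0.
    congr (pr _ * _); apply/seteqP; split=> w /= -[H Zb]; split=> // i.
      by move=> i_n; apply: H; lia.
    by rewrite leq_eqVlt => /orP[/eqP->|/H]; rewrite ?Zb.
  transitivity (\sum_b \sum_a pr (survives n `&` at_ n a) * (step_prob R e a b * h b)).
    apply: eq_bigr => b _; rewrite (@pr_partition _ n); last first.
      by apply: measurableI; [exact: measurable_survives|exact: measurable_at].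
    rewrite big_distrl /=; apply: eq_bigr => a _.
    by rewrite setIAC markov_survives mulrA.
  rewrite exchange_big /= (@pr_partition _ n (measurable_survives n)) /M -sumrB.
  apply: eq_bigr => a _; rewrite -big_distrr /=.
  have [->|ay] := eqVneq a y; first by rewrite sy measure0 !mul0r subr0.
  by rewrite [h a]hE // mulrDr mulr1 addrAC subrr add0r.
have sumE n : \sum_(0 <= i < n) pr (survives i) = h x - M n.
  elim: n => [|n IHn]; first by rewrite big_geq // M0 subrr.
  by rewrite big_nat_recr //= IHn MS; ring.
have M_ge0 n : 0 <= M n.
  by apply: sumr_ge0 => a _; rewrite mulr_ge0 ?pr_ge0.
pose C := \sum_a h a.
have M_le n : M n <= C * pr (survives n).
  rewrite /M /C big_distrl /=; apply: ler_sum => a _; rewrite mulrC.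
  rewrite ler_wpM2l //; apply: fine_le; rewrite ?fin_num_measure //.
    exact: measurable_survives.
  apply: le_measure; rewrite ?inE //; exact: measurable_survives.
(* The partial sums [h x - M n] are bounded by [h x], so the series converges and its terms tend to
   0; by [M_le] so does [M n]. This replaces a separate proof that [y] is reached almost surely. *)
have cvg_sum : cvgn (series (fun n => pr (survives n))).
  apply: nondecreasing_is_cvgn.
    by apply: nondecreasing_series => n _ _; exact: pr_ge0.
  by exists (h x) => _ [n _ <-]; rewrite /series /= sumE gerBl.
have cvg_pr := cvg_series_cvg_0 cvg_sum.
have cvg_M : M n @[n --> \oo] --> (0 : R).
  apply: (@squeeze_cvgr _ _ _ _ (fun=> 0) (fun n => C * pr (survives n))).
  - by near=> n; rewrite M_ge0 M_le.
  - exact: cvg_cst.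
  - by rewrite -(mulr0 C); apply: cvgM => //; exact: cvg_cst.
apply: cvg_lim => //; under eq_fun => n do rewrite sumEFin sumE.
apply: cvg_EFin; first by near=> n.
by rewrite -[X in _ --> X]subr0; apply: cvgB => //; exact: cvg_cst.
Unshelve. all: by end_near.
Qed.

End HittingTime.

(** * Hitting and commute times through forest counts *)

Section CommuteTime.
Variables (R : realType) (V : finType) (e : rel V).
Hypotheses (e_sym : symmetric e) (e_irr : irreflexive e).
Hypothesis e_conn : connected_graph e.

Lemma deg_gt0 u v : u != v -> (0 < deg e u)%N.
Proof.
move=> uv; case/connectP: (e_conn u v) => -[|w p] /=.
  by move=> _ E; rewrite E eqxx in uv.
by case/andP=> uw _ _; apply/card_gt0P; exists w.
Qed.

Lemma expected_hitting_time_forests (d : measure_display)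
    (Omega : measurableType d) (P : probability Omega R) (x y : V)
    (Z : nat -> Omega -> V) : simple_random_walk P e x Z -> x != y ->
  expected_hitting_time P Z y = ((forest_weight e x y)%:R / (tau e)%:R)%:E.
Proof.
move=> HZ xy; have tau0 : (tau e)%:R != 0 :> R.
  by rewrite pnatr_eq0 -lt0n tau_gt0.
pose h a := (forest_weight e a y)%:R / (tau e)%:R : R.
apply: (expected_hitting_timeE HZ (h := h)) => //; rewrite /h.
- by move=> a; rewrite divr_ge0.
- by rewrite forest_weight_id mul0r.
move=> a ay; have d0 : (deg e a)%:R != 0 :> R.
  by rewrite pnatr_eq0 -lt0n (deg_gt0 ay).
transitivity (1 + (\sum_(b | e a b) forest_weight e b y)%:R / (tau e)%:R / (deg e a)%:R : R).
  have /(congr1 (fun n => n%:R : R)) := forest_weight_harmonic e_sym e_irr ay.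
  rewrite natrD !natrM => /esym/(canRL (addrK _)) ->.
  by field; rewrite d0 tau0.
congr (_ + _); rewrite natr_sum !mulr_suml [RHS](bigID (e a)) /= [X in _ + X]big1 ?addr0.
  by apply: eq_bigr => b ab; rewrite /step_prob ab mulrC.
by move=> b /negPf ab; rewrite /step_prob ab mul0r.
Qed.

(** By [forest_weightD] the two hitting times add up to [F2 e x y] times the volume divided by
    [tau e]. *)
Lemma commute_time (x y : V) (d1 : measure_display)
    (Omega1 : measurableType d1) (P1 : probability Omega1 R)
    (Z1 : nat -> Omega1 -> V) (hZ1 : simple_random_walk P1 e x Z1)
    (d2 : measure_display) (Omega2 : measurableType d2)
    (P2 : probability Omega2 R) (Z2 : nat -> Omega2 -> V)
    (hZ2 : simple_random_walk P2 e y Z2) : x != y ->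
  ((F2 e x y)%:R%:E = ((tau e)%:R / (\sum_z deg e z)%:R)%:E *
   (expected_hitting_time P1 Z1 y + expected_hitting_time P2 Z2 x))%E.
Proof.
move=> xy; rewrite (expected_hitting_time_forests hZ1) //.
rewrite (expected_hitting_time_forests hZ2) 1?eq_sym // -EFinD -EFinM.
rewrite -mulrDl -natrD forest_weightD natrM; congr EFin.
have tau0 : (tau e)%:R != 0 :> R by rewrite pnatr_eq0 -lt0n tau_gt0.
have vol0 : (\sum_z deg e z)%:R != 0 :> R.
  by rewrite pnatr_eq0 (bigD1 x) //= addn_eq0 negb_and -lt0n (deg_gt0 xy).
by field; rewrite tau0.
Qed.

End CommuteTime.

(** * The graph of the theorem *)

Section CyclePower.
Variables (N k : nat).
Hypotheses (hk : (0 < k)%N) (hNk : (2 * k + 1 <= N)%N).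

Local Notation C := (@cycle_power N k).

Lemma cycle_power_sym : symmetric C.
Proof.
suff H x y : C x y -> C y x by move=> x y; apply/idP/idP; apply: H.
move=> /existsP[s /andP[s0 Hs]]; apply/existsP; exists s; rewrite s0 /=.
by rewrite -(opprB x y) eqr_oppLR eqr_opp orbC.
Qed.

Lemma val_natZ s : (s < N)%N -> (s%:R : 'Z_N) = s :> nat.
Proof. by move=> sN; rewrite val_Zp_nat ?modn_small //; lia. Qed.

Lemma val_oppnatZ s : (0 < s < N)%N -> (- s%:R : 'Z_N) = (N - s)%N :> nat.
Proof.
by move=> /andP[s0 sN]; rewrite /= val_natZ // Zp_cast ?modn_small //; lia.
Qed.

(** The residues [s] and [-s] with [1 <= s <= k] have representatives [s] and [N - s] below [N],
    which turns adjacency into inequalities of naturals. *)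
Lemma cycle_powerE (x y : 'Z_N) :
  C x y = (0 < (x - y)%R <= k)%N || (N - k <= (x - y)%R)%N.
Proof.
rewrite /cycle_power; move: (x - y) => z; have zN : (z < N)%N.
  by have := ltn_ord z; rewrite {2}Zp_cast //; lia.
apply/existsP/orP => [[s /andP[s0 /orP[]/eqP->]]|].
- by left; rewrite val_natZ; have := ltn_ord s; lia.
- by right; rewrite val_oppnatZ; have := ltn_ord s; lia.
case=> Hz.
  have zk : (z < k.+1)%N by lia.
  exists (Ordinal zk); apply/andP; split; first by rewrite /=; lia.
  by apply/orP; left; apply/eqP/ord_inj; rewrite val_natZ.
have zk : (N - z < k.+1)%N by lia.
exists (Ordinal zk); apply/andP; split; first by rewrite /=; lia.
apply/orP; right; apply/eqP/ord_inj; rewrite val_oppnatZ /=; lia.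
Qed.

Lemma cycle_power_irr : irreflexive C.
Proof. by move=> x; rewrite cycle_powerE subrr /=; lia. Qed.

Lemma cycle_power_regular : regular C (2 * k).
Proof.
move=> x; rewrite /deg.
pose f (s : 'I_k + 'I_k) : 'Z_N :=
  match s with inl s => x - (s.+1)%:R | inr s => x + (s.+1)%:R end.
have -> : #|[pred b | C x b]| = #|codom f|.
  apply: eq_card => y; rewrite inE; apply/existsP/codomP => /=.
    case=> s /andP[s0 Hs]; have sk : (s.-1 < k)%N by have := ltn_ord s; lia.
    have sE : (Ordinal sk).+1 = s :> nat by rewrite /= prednK.
    case/orP: Hs => /eqP Hs; [exists (inl (Ordinal sk))|exists (inr (Ordinal sk))].
      by rewrite /f sE -Hs subKr.
    by rewrite /f sE -[s%:R]opprK -Hs subKr.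
  case=> -[s|s] ->; have sk : (s.+1 < k.+1)%N by rewrite ltnS.
    by exists (Ordinal sk); apply/andP; split=> //; rewrite /f subKr eqxx.
  exists (Ordinal sk); apply/andP; split=> //.
  by rewrite /f opprD addrA subrr add0r eqxx orbT.
rewrite card_codom ?card_sum ?card_ord; first lia.
(* Two shifts between 1 and [k] sum to at most [2k < N], so neither is the opposite of the other
   modulo [N]; hence the [2k] neighbours are distinct. *)
have inj (s t : nat) : (s < k)%N -> (t < k)%N ->
    (s.+1%:R = t.+1%:R :> 'Z_N -> s = t) /\ (s.+1%:R <> - t.+1%:R :> 'Z_N).
  move=> sk tk; split=> /(congr1 (@nat_of_ord _)).
    by rewrite !val_natZ; lia.
  by rewrite val_natZ ?val_oppnatZ; lia.
case=> s [] t /= /addrI E.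
- by have /ord_inj-> := (inj _ _ (ltn_ord s) (ltn_ord t)).1 (oppr_inj E).
- by case: ((inj _ _ (ltn_ord t) (ltn_ord s)).2 (esym E)).
- by case: ((inj _ _ (ltn_ord s) (ltn_ord t)).2 E).
- by have /ord_inj-> := (inj _ _ (ltn_ord s) (ltn_ord t)).1 E.
Qed.

Lemma cycle_power_connected : connected_graph C.
Proof.
(* Steps of length 1, available because [k > 0], reach every vertex. *)
have step (a : 'Z_N) n : connect C a (a + n%:R).
  elim: n => [|n IHn]; first by rewrite addr0.
  apply: connect_trans IHn (connect1 _); apply/existsP.
  have k1 : (1 < k.+1)%N by lia.
  by exists (Ordinal k1); rewrite /= -natr1 addrA opprD addNKr eqxx orbT.
by move=> a b; have := step a (b - a : 'Z_N); rewrite natr_Zp addrC subrK.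
Qed.

End CyclePower.

Section CartesianProduct.
Variables (V W : finType) (e : rel V) (f : rel W).

Local Notation X := (cartesian_product e f).

Lemma cartesian_product_sym : symmetric e -> symmetric f -> symmetric X.
Proof.
move=> es fs p q.
by rewrite /cartesian_product es fs (eq_sym p.1) (eq_sym p.2).
Qed.

Lemma cartesian_product_irr : irreflexive e -> irreflexive f -> irreflexive X.
Proof. by move=> ei fi p; rewrite /cartesian_product ei fi !andbF. Qed.

Lemma cartesian_product_connected :
  connected_graph e -> connected_graph f -> connected_graph X.
Proof.
move=> ec fc [a b] [c d]; apply: (@connect_trans _ _ (c, b)).
  case/connectP: (ec a c) => p ep ->; apply/connectP; exists [seq (z, b) | z <- p].
    elim: p a ep => //= z p IHp a /andP[az zp].
    by rewrite IHp // andbT /cartesian_product /= eqxx az.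
  by rewrite (last_map (fun z => (z, b))).
case/connectP: (fc b d) => p fp ->; apply/connectP; exists [seq (c, z) | z <- p].
  elim: p b fp => //= z p IHp b /andP[bz zp].
  by rewrite IHp // andbT /cartesian_product /= eqxx bz orbT.
by rewrite (last_map (fun z => (c, z))).
Qed.

(** Neighbours are split by whether they keep the second coordinate: those that do are moves along
    [e], the others moves along [f], which change it by irreflexivity of [f]. *)
Lemma cartesian_product_regular r s : irreflexive e -> irreflexive f ->
  regular e r -> regular f s -> regular X (r + s).
Proof.
move=> ei fi er fs [a b]; rewrite /deg -(cardID [pred q : V * W | q.2 == b]).
have inj1 : injective (fun z : V => (z, b)) by move=> ? ? [].
have inj2 : injective (fun z : W => (a, z)) by move=> ? ? [].
rewrite -(er a) -(fs b) /deg -(fintype.card_image inj1 [pred c | e a c]).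
rewrite -(fintype.card_image inj2 [pred c | f b c]).
congr (_ + _)%N; apply: eq_card => -[c d]; rewrite !inE /cartesian_product /=.
  have [->|Nd] := eqVneq d b; last first.
    by rewrite andbF; apply/esym/negP => /fintype.imageP[z _ [_ E]]; rewrite E eqxx in Nd.
  by rewrite andbT /= fi andbF orbF (fintype.mem_image inj1).
have [->|Nd] := eqVneq d b.
  by apply/esym/negP => /fintype.imageP[z fz [_ E]]; move: fz; rewrite -E inE fi.
rewrite /=; have [<-|Na] := eqVneq a c; first by rewrite (fintype.mem_image inj2).
by apply/esym/negP => /fintype.imageP[z _ [E _]]; rewrite E eqxx in Na.
Qed.

End CartesianProduct.

Theorem proposition5p6 (R : realType) (N k r m : nat)
    (hN : (0 < N)%N) (hk : (0 < k)%N) (hNk : (2 * k + 1 <= N)%N)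
    (V : finType) (G : rel V)
    (Gsym : symmetric G) (Girr : irreflexive G)
    (Gconn : connected_graph G) (Greg : regular G r) (Gcard : #|V| = m)
    (x y : ('Z_N * V)%type) (hxy : x != y)
    (d1 : measure_display) (Omega1 : measurableType d1)
    (P1 : probability Omega1 R) (Z1 : nat -> Omega1 -> ('Z_N * V)%type)
    (hZ1 : simple_random_walk P1 (cartesian_product (@cycle_power N k) G) x Z1)
    (d2 : measure_display) (Omega2 : measurableType d2)
    (P2 : probability Omega2 R) (Z2 : nat -> Omega2 -> ('Z_N * V)%type)
    (hZ2 : simple_random_walk P2 (cartesian_product (@cycle_power N k) G) y Z2) :
  let X := cartesian_product (@cycle_power N k) G in
  ((F2 X x y)%:R%:E =
   ((tau X)%:R / (N * m * (2 * k + r))%:R)%:E *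
   (expected_hitting_time P1 Z1 y + expected_hitting_time P2 Z2 x))%E.
Proof.
have Csym := @cycle_power_sym N k; have Cirr := cycle_power_irr hk hNk.
have Cconn := cycle_power_connected hk hNk.
have Creg := cycle_power_regular hk hNk.
have Xreg := cartesian_product_regular Cirr Girr Creg Greg.
(* The bounds on [k] and [N] give [N >= 3], so ['Z_N] really has [N] elements. *)
have cardZ : #|'Z_N| = N by rewrite card_ord Zp_cast //; lia.
have Xsym := cartesian_product_sym Csym Gsym.
have Xirr := cartesian_product_irr Cirr Girr.
have Xconn := cartesian_product_connected Cconn Gconn.
rewrite /= (commute_time Xsym Xirr Xconn hZ1 hZ2 hxy).
(* By regularity the volume is the degree [2k + r] times the number [N m] of vertices. *)
by rewrite (eq_bigr _ (fun z _ => Xreg z)) sum_nat_const card_prod cardZ Gcard.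
Qed.
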